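(* Let $(A,\circ_A,P,\omega)$ be a quadratic Rota-Baxter Zinbiel algebra of weight $\lambda$ with $\lambda\neq0$, and let $\mathcal{I}_\omega:A^*\to A$ be the induced linear isomorphism given by $\langle\mathcal{I}_\omega^{-1}x,y\rangle=\omega(x,y)$ for all $x,y\in A$. Then $r\in A\otimes A$ defined by $$r_+=\frac1\lambda(P+\lambda\,\mathrm{Id})\circ\mathcal{I}_\omega:A^*\to A,\qquad r_+(\xi)=r(\xi,\cdot),\quad\forall\xi\in A^*,$$ satisfies $[\![r,r]\!]=0$ and gives rise to a factorizable Zinbiel bialgebra $(A,A_r^* )$.
   Context: All vector spaces are finite-dimensional over a field $\mathbb{K}$ of characteristic different from $2$. A Zinbiel algebra $(A,\circ_A)$ is a vector space with a bilinear product satisfying $x\circ_A(y\circ_A z)=(x\circ_A y+y\circ_A x)\circ_A z$. Write $x\ast_A y=x\circ_A y+y\circ_A x$, $L_x(y)=x\circ_A y$, $R_x(y)=y\circ_A x$, $\langle L_x^*\xi,y\rangle=-\langle\xi,x\circ_A y\rangle$, $\langle R_x^*\xi,y\rangle=-\langle\xi,y\circ_A x\rangle$ ($\xi\in A^*$). A quadratic Rota-Baxter Zinbiel algebra of weight $\lambda$ is a quadruple $(A,\circ_A,P,\omega)$ where $(A,\circ_A)$ is a Zinbiel algebra; $P:A\to A$ is linear with $P(x)\circ_A P(y)=P(P(x)\circ_A y+x\circ_A P(y)+\lambda x\circ_A y)$; $\omega$ is a nondegenerate skew-symmetric bilinear form with $\omega(x\circ_A y,z)=\omega(y,x\circ_A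 z+z\circ_A x)$; and $\omega(Px,y)+\omega(x,Py)+\lambda\omega(x,y)=0$, for all $x,y,z\in A$. For $r=\sum_i a_i\otimes b_i\in A\otimes A$ define $r_\pm:A^*\to A$ by $\langle r_+(\xi),\eta\rangle=r(\xi,\eta)=\langle\xi,r_-(\eta)\rangle$, put $I=r_+-r_-:A^*\to A$, let $a$ be the skew-symmetric part of $r$, and let $$[\![r,r]\!]=\sum_{i,j}\big(-a_i\circ_A a_j\otimes b_j\otimes b_i-b_j\otimes a_i\circ_A a_j\otimes b_i+a_i\ast_A b_j\otimes a_j\otimes b_i+a_i\otimes b_i\ast_A a_j\otimes b_j-a_i\otimes a_j\otimes b_i\ast_A b_j\big).$$ An element $s\in A\otimes A$ is $(L,L+R)$-invariant if $(L_x\otimes\mathrm{Id}-\mathrm{Id}\otimes(L_x+R_x))s=0$ for all $x\in A$. If $[\![r,r]\!]=0$ and $a$ is $(L,L+R)$-invariant, then $\alpha(x)=(\mathrm{Id}\otimes(L_x+R_x)-L_x\otimes\mathrm{Id})r$ makes $(A,A^* )$ a Zinbiel bialgebra with product $\xi\cdot_r\eta=-(L^*_{r_+(\xi)}+R^*_{r_+(\xi)})\eta+R^*_{r_-(\eta)}\xi$ on $A^*$ (denoted $A_r^*$); this $(A,A_r^* )$ is called the quasi-triangular Zinbiel bialgebra induced by $r$. It is called factorizable if $a$ is nondegenerate, i.e. if $I:A^*\to A$ is a linear isomorphism. (A Zinbiel bialgebra is a pair of Zinbiel algebra structures on $A$ and $A^*$, dual to maps $\beta:A^*\to A^*\otimes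 A^*$ and $\alpha:A\to A\otimes A$ respectively, with $\alpha(x\ast_A y)=(L_x\otimes\mathrm{Id})\alpha(y)+(\mathrm{Id}\otimes(L_y+R_y))\alpha(x)$ and $\beta(\xi\ast_{A^*}\eta)=(\mathcal{L}_\xi\otimes\mathrm{Id})\beta(\eta)+(\mathrm{Id}\otimes(\mathcal{L}_\eta+\mathcal{R}_\eta))\beta(\xi)$, where $\mathcal{L},\mathcal{R}$ are left and right multiplications of $A^*$ and $\xi\ast_{A^*}\eta$ is the symmetrized product of $A^*$.) *)

(* Defs.v *)
From HB Require Import structures.
From mathcomp Require Import all_boot all_order all_algebra.

Set Implicit Arguments.
Unset Strict Implicit.
Unset Printing Implicit Defensive.

Import GRing.Theory VectorInternalTheory.

Local Open Scope ring_scope.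
Local Open Scope lfun_scope.

Reserved Notation "u \ox v" (at level 41, right associativity).

Notation dual A := 'Hom(A, GRing.regular _).

Section BilinearFor.

Variables (K : fieldType) (U V W : vectType K).
Implicit Types f g : U -> V -> W.
Local Notation bilin := (bilinear_for *:%R *:%R).

Lemma bilinear_forD f g :
  bilin f -> bilin g -> bilin (fun u v => f u v + g u v).
Proof.
by case=> fl fr [gl gr]; split=> u c x y /=;
  rewrite ?fl ?gl ?fr ?gr scalerDr addrACA.
Qed.

Lemma bilinear_forN f : bilin f -> bilin (fun u v => - f u v).
Proof.
by case=> fl fr; split=> u c x y /=; rewrite ?fl ?fr opprD scalerN.
Qed.

Lemma bilinear_for_sum n (f : 'I_n -> U -> V -> W) :
  (forall i, bilin (f i)) -> bilin (fun u v => \sum_i f i u v).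
Proof.
move=> fB; split=> u c x y /=; rewrite scaler_sumr -big_split /=;
  by apply: eq_bigr => i _; case: (fB i) => fl fr; rewrite ?fl ?fr.
Qed.

End BilinearFor.

(* The tensor product is realised by coordinate matrices; [tlift_pure] and    *)
(* [tlift_uniq] give its universal property, so that nothing below depends on *)
(* the bases of U and V provided by [v2r].                                    *)
Definition tensor (K : fieldType) (U V : vectType K) : vectType K :=
  'M[K]_(dim U, dim V).

Section Tensor.

Variables (K : fieldType) (U V : vectType K).

Definition tpure (u : U) (v : V) : tensor U V := (v2r u)^T *m v2r v.

Lemma tpure_bilinear : bilinear_for *:%R *:%R tpure.
Proof.
split=> [v|u] c x y; rewrite /tpure linearP /=.
  by rewrite linearP /= mulmxDl -scalemxAl.
by rewrite mulmxDr -scalemxAr.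
Qed.

HB.instance Definition _ :=
  bilinear_isBilinear.Build K U V (tensor U V) *:%R *:%R tpure tpure_bilinear.

Definition tlift (W : vectType K) (f : U -> V -> W) (t : tensor U V) : W :=
  \sum_i \sum_j (t : 'M_(_, _)) i j *: f (r2v 'e_i) (r2v 'e_j).

Lemma tlift_linear (W : vectType K) (f : U -> V -> W) : linear (tlift f).
Proof.
move=> c s t; rewrite /tlift scaler_sumr -big_split; apply: eq_bigr => i _ /=.
rewrite scaler_sumr -big_split; apply: eq_bigr => j _ /=.
by rewrite !mxE scalerDl scalerA.
Qed.

HB.instance Definition _ (W : vectType K) (f : U -> V -> W) :=
  GRing.isLinear.Build K (tensor U V) W *:%R (tlift f) (tlift_linear f).

Lemma eq_tlift (W : vectType K) (f g : U -> V -> W) :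
  (forall u v, f u v = g u v) -> tlift f =1 tlift g.
Proof.
by move=> fg t; apply: eq_bigr => i _; apply: eq_bigr => j _; rewrite fg.
Qed.

End Tensor.

Notation "u \ox v" := (tpure u v) : ring_scope.

Section TensorTheory.

Variables (K : fieldType) (U V W : vectType K).

Lemma v2r_decomp (T : vectType K) (u : T) : u = \sum_i v2r u 0 i *: r2v 'e_i.
Proof.
rewrite -[LHS]v2rK {1}[v2r u]row_sum_delta linear_sum.
by apply: eq_bigr => i _; rewrite linearZ.
Qed.

Lemma tlift_pure (f : U -> V -> W) :
  bilinear_for *:%R *:%R f -> forall u v, tlift f (u \ox v) = f u v.
Proof.
move=> [fl fr] u v.
have fls s (P : 'I_s -> U) y : f (\sum_i P i) y = \sum_i f (P i) y.
  pose F : {linear U -> W} := HB.pack (f^~ y)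
    (GRing.isLinear.Build K U W *:%R (f^~ y) (fl y)).
  exact: (linear_sum F).
have frs s x (P : 'I_s -> V) : f x (\sum_i P i) = \sum_i f x (P i).
  pose F : {linear V -> W} := HB.pack (f x)
    (GRing.isLinear.Build K V W *:%R (f x) (fr x)).
  exact: (linear_sum F).
have f0l y : f 0 y = 0 by have := fl y (-1) 0 0; rewrite /= scaler0 addr0 scaleN1r addNr.
have f0r x : f x 0 = 0 by have := fr x (-1) 0 0; rewrite /= scaler0 addr0 scaleN1r addNr.
have flZ c x y : f (c *: x) y = c *: f x y.
  by have := fl y c x 0; rewrite f0l !addr0.
have frZ c x y : f x (c *: y) = c *: f x y.
  by have := fr x c y 0; rewrite f0r !addr0.
rewrite [in RHS](v2r_decomp u) fls; apply: eq_bigr => i _.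
rewrite flZ [in RHS](v2r_decomp v) frs scaler_sumr; apply: eq_bigr => j _.
by rewrite frZ scalerA !mxE big_ord1 !mxE.
Qed.

Lemma tensor_sum (t : tensor U V) :
  t = \sum_i \sum_j (t : 'M_(_, _)) i j *: (r2v 'e_i \ox r2v 'e_j).
Proof.
rewrite {1}[t]matrix_sum_delta; apply: eq_bigr => i _; apply: eq_bigr => j _.
congr (_ *: _); rewrite /tpure !r2vK.
apply/matrixP => k l; rewrite !mxE big_ord1 !mxE !eqxx /=.
by rewrite -natrM mulnb.
Qed.

Lemma tlift_uniq (f g : {linear tensor U V -> W}) :
  (forall u v, f (u \ox v) = g (u \ox v)) -> f =1 g.
Proof.
move=> fg t; rewrite [t]tensor_sum (linear_sum f) (linear_sum g).
apply: eq_bigr => i _; rewrite (linear_sum f) (linear_sum g); apply: eq_bigr => j _.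
by rewrite (linearZ_LR f) (linearZ_LR g) fg.
Qed.

Lemma tlift_sum (f : U -> V -> W) n (a : 'I_n -> U) (b : 'I_n -> V) :
  bilinear_for *:%R *:%R f ->
  tlift f (\sum_i a i \ox b i) = \sum_i f (a i) (b i).
Proof.
by move=> fB; rewrite (linear_sum (tlift f)); apply: eq_bigr => i _; apply: tlift_pure.
Qed.

End TensorTheory.

Section TensorOps.

Variable K : fieldType.

Definition tmap (U V U' V' : vectType K) (f : 'Hom(U, U')) (g : 'Hom(V, V')) :
    tensor U V -> tensor U' V' :=
  tlift (fun u v => f u \ox g v).

Definition tswap (U V : vectType K) : tensor U V -> tensor V U :=
  tlift (fun u v => v \ox u).

Definition tpair (U V : vectType K) (xi : dual U) (eta : dual V)
    (t : tensor U V) : K^o :=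
  tlift (fun u v => xi u * eta v : K^o) t.

(* The value of an element of the dual tensor square on x \ox y. *)
Definition tpairV (U V : vectType K) (t : tensor (dual U) (dual V))
    (x : U) (y : V) : K^o :=
  tlift (fun (xi : dual U) (eta : dual V) => xi x * eta y : K^o) t.

Lemma tmap_pure (U V U' V' : vectType K) (f : 'Hom(U, U')) (g : 'Hom(V, V'))
  u v : tmap f g (u \ox v) = f u \ox g v.
Proof.
apply: (tlift_pure (f := fun u v => f u \ox g v)).
by split=> w c x y; rewrite linearP ?linearPl ?linearPr.
Qed.

Lemma tswap_pure (U V : vectType K) (u : U) (v : V) : tswap (u \ox v) = v \ox u.
Proof.
apply: (tlift_pure (f := fun u v => v \ox u)).
by split=> w c x y; rewrite ?linearPl ?linearPr.
Qed.

Lemma tpair_pure (U V : vectType K) (xi : dual U) (eta : dual V) u v :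
  tpair xi eta (u \ox v) = xi u * eta v.
Proof.
apply: (tlift_pure (f := fun u v => xi u * eta v : K^o)).
split=> w c x y; rewrite linearP /= ?mulrDl ?mulrDr.
  by rewrite -scalerAl.
by rewrite -scalerAr.
Qed.

Lemma tpairV_pure (U V : vectType K) (xi : dual U) (eta : dual V) x y :
  tpairV (xi \ox eta) x y = xi x * eta y.
Proof.
apply: (tlift_pure
  (f := fun (xi : dual U) (eta : dual V) => xi x * eta y : K^o)).
split=> w c f g; rewrite add_lfunE scale_lfunE ?mulrDl ?mulrDr.
  by rewrite -scalerAl.
by rewrite -scalerAr.
Qed.

Variable A : vectType K.
Implicit Types (r : tensor A A) (xi eta : dual A).

Definition rplus_fun r xi : A := tlift (fun a b => xi a *: b) r.
Definition rminus_fun r eta : A := tlift (fun a b => eta b *: a) r.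

Lemma rplus_linear r : linear (rplus_fun r).
Proof.
move=> c f g; rewrite /rplus_fun /tlift scaler_sumr -big_split.
apply: eq_bigr => i _ /=; rewrite scaler_sumr -big_split.
apply: eq_bigr => j _ /=; rewrite add_lfunE scale_lfunE.
by rewrite scalerDl scalerDr !scalerA mulrCA -!mulrA.
Qed.

Lemma rminus_linear r : linear (rminus_fun r).
Proof.
move=> c f g; rewrite /rminus_fun /tlift scaler_sumr -big_split.
apply: eq_bigr => i _ /=; rewrite scaler_sumr -big_split.
apply: eq_bigr => j _ /=; rewrite add_lfunE scale_lfunE.
by rewrite scalerDl scalerDr !scalerA mulrCA -!mulrA.
Qed.

HB.instance Definition _ r :=
  GRing.isLinear.Build K (dual A) A *:%R (rplus_fun r) (rplus_linear r).
HB.instance Definition _ r :=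
  GRing.isLinear.Build K (dual A) A *:%R (rminus_fun r) (rminus_linear r).

Definition rplus r : 'Hom(dual A, A) := linfun (rplus_fun r).
Definition rminus r : 'Hom(dual A, A) := linfun (rminus_fun r).

Lemma rplusP r xi eta : eta (rplus r xi) = tpair xi eta r.
Proof.
rewrite lfunE /= /rplus_fun /tpair /tlift (linear_sum eta).
apply: eq_bigr => i _; rewrite (linear_sum eta); apply: eq_bigr => j _ /=.
by rewrite !(linearZ_LR eta).
Qed.

Lemma rminusP r xi eta : xi (rminus r eta) = tpair xi eta r.
Proof.
rewrite lfunE /= /rminus_fun /tpair /tlift (linear_sum xi).
apply: eq_bigr => i _; rewrite (linear_sum xi); apply: eq_bigr => j _ /=.
by rewrite !(linearZ_LR xi) /=; congr (_ *: _); rewrite mulrC.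
Qed.

Definition skew_part r : tensor A A := 2^-1 *: (r - tswap r).

End TensorOps.

Section Zinbiel.

Variables (K : fieldType) (A : vectType K) (mul : {bilinear A -> A -> A}).
Implicit Types (x y z : A) (r s : tensor A A) (xi eta : dual A).

Definition star x y : A := mul x y + mul y x.
Definition lmul x : 'End(A) := linfun (mul x).
Definition rmul x : 'End(A) := linfun (applyr mul x).

Lemma lmulE x y : lmul x y = mul x y. Proof. exact: lfunE. Qed.
Lemma rmulE x y : rmul x y = mul y x. Proof. exact: lfunE. Qed.

Definition zinbiel : Prop :=
  forall x y z, mul x (mul y z) = mul (star x y) z.

Definition rota_baxter (lambda : K) (P : 'End(A)) : Prop :=
  forall x y, mul (P x) (P y) =
    P (mul (P x) y + mul x (P y) + lambda *: mul x y).

Definition colmul x xi : dual A := - (xi \o lmul x).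
Definition cormul x xi : dual A := - (xi \o rmul x).

Lemma colmulE x xi y : colmul x xi y = - xi (mul x y).
Proof. by rewrite opp_lfunE comp_lfunE lmulE. Qed.

Lemma cormulE x xi y : cormul x xi y = - xi (mul y x).
Proof. by rewrite opp_lfunE comp_lfunE rmulE. Qed.

Definition L_LR_invariant s : Prop :=
  forall x, tmap (lmul x) \1 s - tmap \1 (lmul x + rmul x) s = 0.

Definition coboundary r x : tensor A A :=
  tmap \1 (lmul x + rmul x) r - tmap (lmul x) \1 r.

Lemma coboundary_linear r : linear (coboundary r).
Proof.
have lmulP c x y z : lmul (c *: x + y) z = c *: lmul x z + lmul y z.
  by rewrite !lmulE linearPl.
have rmulP c x y z : rmul (c *: x + y) z = c *: rmul x z + rmul y z.
  by rewrite !rmulE linearPr.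
move=> c x y; rewrite /coboundary scalerBr addrACA -opprD.
congr (_ - _); rewrite /tmap /tlift scaler_sumr -big_split;
  apply: eq_bigr => i _ /=; rewrite scaler_sumr -big_split;
  apply: eq_bigr => j _ /=; rewrite scalerA [c * _]mulrC -scalerA -scalerDr;
  congr (_ *: _); rewrite ?add_lfunE ?lmulP ?rmulP ?linearPl -?linearPr //.
by rewrite scalerDr addrACA.
Qed.

HB.instance Definition _ r :=
  GRing.isLinear.Build K A (tensor A A) *:%R (coboundary r)
    (coboundary_linear r).

Definition zybe_term (a b a' b' : A) : tensor A (tensor A A) :=
  - (mul a a' \ox b' \ox b) - (b' \ox mul a a' \ox b)
  + (star a b' \ox a' \ox b) + (a \ox star b a' \ox b')
  - (a \ox a' \ox star b b').

(* [zybe r] is [[r, r]]: by [zybe_sum] it is computed by the usual formula    *)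
(* from any decomposition of r as a sum of pure tensors.                      *)
Definition zybe r : tensor A (tensor A A) :=
  tlift (fun a b => tlift (fun a' b' => zybe_term a b a' b') r) r.

Lemma starPr c x y z : star x (c *: y + z) = c *: star x y + star x z.
Proof. by rewrite /star linearPl linearPr scalerDr addrACA. Qed.

Lemma starPl c x y z : star (c *: y + z) x = c *: star y x + star z x.
Proof. by rewrite /star linearPl linearPr scalerDr addrACA. Qed.

Lemma zybe_term_bilinear_r a b :
  bilinear_for *:%R *:%R (fun a' b' => zybe_term a b a' b').
Proof.
by do !(apply: bilinear_forD || apply: bilinear_forN);
  split=> w c x y; rewrite !(linearPl, linearPr, starPr, starPl).
Qed.

Lemma zybe_term_bilinear_l a' b' :
  bilinear_for *:%R *:%R (fun a b => zybe_term a b a' b').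
Proof.
by do !(apply: bilinear_forD || apply: bilinear_forN);
  split=> w c x y; rewrite !(linearPl, linearPr, starPr, starPl).
Qed.

Lemma zybe_sum n (a b : 'I_n -> A) :
  zybe (\sum_i a i \ox b i) =
  \sum_i \sum_j
    (- (mul (a i) (a j) \ox b j \ox b i) - (b j \ox mul (a i) (a j) \ox b i)
     + (star (a i) (b j) \ox a j \ox b i) + (a i \ox star (b i) (a j) \ox b j)
     - (a i \ox a j \ox star (b i) (b j))).
Proof.
rewrite /zybe.
under eq_tlift => x y do rewrite (tlift_sum _ _ (zybe_term_bilinear_r x y)).
rewrite tlift_sum //; apply: bilinear_for_sum => j.
exact: zybe_term_bilinear_l.
Qed.

Definition dual_mul r xi eta : dual A :=
  - (colmul (rplus r xi) eta + cormul (rplus r xi) eta)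
  + cormul (rminus r eta) xi.

Lemma dual_mulE r xi eta x :
  dual_mul r xi eta x = eta (star (rplus r xi) x) - xi (mul x (rminus r eta)).
Proof.
rewrite /dual_mul add_lfunE cormulE opp_lfunE add_lfunE colmulE cormulE.
by rewrite opprD !opprK /star linearD.
Qed.

Lemma dual_mul_bilinear r : bilinear_for *:%R *:%R (dual_mul r).
Proof.
split=> zeta c xi eta; apply/lfunP => x;
  rewrite /= [LHS]dual_mulE [RHS]add_lfunE scale_lfunE !dual_mulE;
  rewrite add_lfunE scale_lfunE.
  rewrite (linearP (rplus r)) starPl (linearP zeta).
  by rewrite scalerBr opprD addrACA.
rewrite (linearP (rminus r)) linearPr (linearP zeta).
by rewrite scalerBr opprD addrACA.
Qed.

HB.instance Definition _ r :=
  bilinear_isBilinear.Build K (dual A) (dual A) (dual A) *:%R *:%R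
    (dual_mul r) (dual_mul_bilinear r).

Definition zinbiel_cocycle (delta : A -> tensor A A) : Prop :=
  forall x y, delta (star x y) =
    tmap (lmul x) \1 (delta y) + tmap \1 (lmul y + rmul y) (delta x).

Record quadratic_rota_baxter_zinbiel (P : 'End(A)) (omega : {skew_symmetric A})
    (lambda : K) : Prop := QuadraticRotaBaxterZinbiel {
  qrb_zinbiel : zinbiel;
  qrb_rota_baxter : rota_baxter lambda P;
  qrb_nondegenerate : nondegenerate omega;
  qrb_invariant : forall x y z, omega (mul x y) z = omega y (star x z);
  qrb_compatible : forall x y,
    omega (P x) y + omega x (P y) + lambda * omega x y = 0
}.

End Zinbiel.

Section Bialgebra.

Variables (K : fieldType) (A : vectType K).

Record zinbiel_bialgebra (mul : {bilinear A -> A -> A})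
    (dmul : {bilinear dual A -> dual A -> dual A})
    (alpha : {linear A -> tensor A A})
    (beta : {linear dual A -> tensor (dual A) (dual A)}) : Prop :=
  ZinbielBialgebra {
  bialg_zinbiel : zinbiel mul;
  bialg_dual_zinbiel : zinbiel dmul;
  bialg_alpha : forall x xi eta, tpair xi eta (alpha x) = dmul xi eta x;
  bialg_beta : forall xi x y, tpairV (beta xi) x y = xi (mul x y);
  bialg_cocycle : zinbiel_cocycle mul alpha;
  bialg_dual_cocycle : zinbiel_cocycle dmul beta
}.

Variables (mul : {bilinear A -> A -> A}) (r : tensor A A).

Record quasitriangular_zinbiel_bialgebra : Prop :=
  QuasitriangularZinbielBialgebra {
  qt_zybe : zybe mul r = 0;
  qt_invariant : L_LR_invariant mul (skew_part r);
  qt_bialgebra : exists beta,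
    zinbiel_bialgebra mul (dual_mul mul r) (coboundary mul r) beta
}.

(* rplus r - rminus r is the map I : A^* -> A, which is twice the map         *)
(* attached to [skew_part r]; its bijectivity is the nondegeneracy of the     *)
(* skew part.                                                                 *)
Definition factorizable_zinbiel_bialgebra : Prop :=
  quasitriangular_zinbiel_bialgebra /\ bijective (rplus r - rminus r).

End Bialgebra.

Section FormIso.

Variables (K : fieldType) (A : vectType K) (omega : {skew_symmetric A}).

Definition form_flat : 'Hom(A, dual A) :=
  linfun (fun x => linfun (omega x : A -> K^o) : dual A).

(* I_omega, the inverse of x |-> omega(x, -); [inv_lfun] is a genuine inverse *)
(* when omega is nondegenerate, by [form_isoK] and [form_isoVK].              *)
Definition form_iso : 'Hom(dual A, A) := form_flat^-1.

Lemma form_flatE x y : form_flat x y = omega x y.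
Proof.
have rl z : linear (omega z : A -> K^o).
  by move=> c u v; rewrite linearPr.
have rE z u : linfun (omega z : A -> K^o) u = omega z u.
  pose F : {linear A -> K^o} := HB.pack (omega z : A -> K^o)
    (GRing.isLinear.Build K A K^o *:%R (omega z : A -> K^o) (rl z)).
  exact: (lfunE F).
pose f0 z : dual A := linfun (omega z : A -> K^o).
have f0l : linear f0.
  move=> c u v; apply/lfunP => w; rewrite add_lfunE scale_lfunE !rE.
  by rewrite linearPl.
pose F : {linear A -> dual A} := HB.pack f0
  (GRing.isLinear.Build K A (dual A) *:%R f0 f0l).
by rewrite /form_flat (lfunE F) rE.
Qed.

Lemma form_flat_ker : nondegenerate omega -> lker form_flat == 0%VS.
Proof.
move=> /eqP nd; rewrite -subv0; apply/subvP => x.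
rewrite memv_ker => /eqP fx0; rewrite -nd; apply/mem_orthovP => y _.
by rewrite -form_flatE fx0 zero_lfunE.
Qed.

Lemma form_isoK : nondegenerate omega -> cancel form_flat form_iso.
Proof. by move=> nd; apply/lker0_lfunK/form_flat_ker. Qed.

Lemma form_isoVK : nondegenerate omega -> cancel form_iso form_flat.
Proof.
move=> nd xi; apply: limg_lfunVK.
suff -> : limg form_flat = fullv by apply: memvf.
apply/eqP; rewrite eqEdim subvf limg_dim_eq ?capfv ?(eqP (form_flat_ker nd)) //.
by rewrite !dimvf /dim /= muln1.
Qed.

End FormIso.

(* Main.v *)
Require Import Defs.
From HB Require Import structures.
From mathcomp Require Import all_boot all_order all_algebra.
From mathcomp Require Import ring.

Set Implicit Arguments.
Unset Strict Implicit.
Unset Printing Implicit Defensive.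

Import GRing.Theory VectorInternalTheory.
Local Open Scope ring_scope.
Local Open Scope lfun_scope.

(* Replacing P by P / lambda reduces to weight 1.  Write J : A -> A^* for         *)
(* x |-> omega(x, -).  Then r_+ (J x) = P x + x, and compatibility of P with      *)
(* omega gives r_- (J x) = P x, so that I = r_+ - r_- is the inverse of J.        *)
(* Invariance of omega turns the product of A_r^* into the Rota-Baxter product    *)
(* P x o y + x o P y + x o y, which is again Zinbiel.  Since J is onto, the       *)
(* remaining identities may be tested on vectors J x and become identities        *)
(* omega(u, z) = omega(v, z) with u, v in A.  For [[r, r]] = 0 the identity u = v *)
(* is the weight 1 Rota-Baxter equation for P, symmetrized; for the cocycle       *)
(* condition on A^* it only uses that the symmetrized product of A is associative *)
(* and commutative.                                                               *)

(** Every tensor identity is tested on covectors or, over the dual, on vectors ([tpair_inj],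
    [tpairV_inj], [tpair3_eq0]), and [rplusP], [rminusP] turn pairings with [r] into values of
    [rplus r] and [rminus r]. The cocycle condition on [A] then holds for every [r]
    ([coboundary_cocycle]). The others use the quadratic structure through [rplusJ], [rminusJ] and
    [dual_mulJ]: see [zybe_eq0], [rplusBrminus_invariant], [dual_mul_zinbiel] and
    [dual_mul_cocycle]. *)

HB.instance Definition _ (K : fieldType) (U V : vectType K) (xi : dual U)
    (eta : dual V) :=
  GRing.isLinear.Build K (tensor U V) (GRing.regular K) *:%R (tpair xi eta)
    (tlift_linear _).

HB.instance Definition _ (K : fieldType) (U V U' V' : vectType K)
    (f : 'Hom(U, U')) (g : 'Hom(V, V')) :=
  GRing.isLinear.Build K (tensor U V) (tensor U' V') *:%R (tmap f g)
    (tlift_linear _).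

HB.instance Definition _ (K : fieldType) (U V : vectType K) :=
  GRing.isLinear.Build K (tensor U V) (tensor V U) *:%R (@tswap K U V)
    (tlift_linear _).

(** * Coordinate covectors and the bidual *)

Section DualBasis.

Variables (K : fieldType) (U : vectType K).

Definition coord_form (i : 'I_(dim U)) : dual U :=
  linfun (fun u : U => v2r u 0 i : K^o).

Lemma coord_formE i u : coord_form i u = v2r u 0 i.
Proof.
have lin : linear (fun u : U => v2r u 0 i : K^o).
  by move=> c x y; rewrite linearP !mxE.
pose F : {linear U -> K^o} := HB.pack (fun u : U => v2r u 0 i : K^o)
  (GRing.isLinear.Build K U K^o *:%R (fun u : U => v2r u 0 i : K^o) lin).
exact: (lfunE F).
Qed.

Lemma coord_form_basis i j : coord_form i (r2v 'e_j) = (j == i)%:R.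
Proof. by rewrite coord_formE r2vK mxE eqxx eq_sym. Qed.

Lemma dual_decomp (xi : dual U) : xi = \sum_i xi (r2v 'e_i) *: coord_form i.
Proof.
apply/lfunP => u; rewrite [in LHS](v2r_decomp u) linear_sum sum_lfunE.
apply: eq_bigr => i _.
by rewrite linearZ scale_lfunE coord_formE /= [RHS]mulrC.
Qed.

Lemma coord_form_decomp u : u = \sum_i coord_form i u *: r2v 'e_i.
Proof.
by rewrite [LHS]v2r_decomp; apply: eq_bigr => i _; rewrite coord_formE.
Qed.

Lemma dual_separates (u v : U) : (forall xi : dual U, xi u = xi v) -> u = v.
Proof.
move=> uv; rewrite (coord_form_decomp u) (coord_form_decomp v).
by apply: eq_bigr => i _; rewrite uv.
Qed.

Definition evalf (u : U) : dual (dual U) := linfun (fun xi : dual U => xi u).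

Lemma evalfE u xi : evalf u xi = xi u.
Proof.
have lin : linear (fun xi : dual U => xi u).
  by move=> c x y; rewrite add_lfunE scale_lfunE.
pose F : {linear dual U -> K^o} := HB.pack (fun xi : dual U => xi u)
  (GRing.isLinear.Build K (dual U) K^o *:%R (fun xi : dual U => xi u) lin).
exact: (lfunE F).
Qed.

Lemma evalf_surj (phi : dual (dual U)) : exists u, phi = evalf u.
Proof.
exists (\sum_i phi (coord_form i) *: r2v 'e_i); apply/lfunP => xi.
rewrite evalfE [in LHS](dual_decomp xi) (linear_sum phi) (linear_sum xi).
apply: eq_bigr => i _.
by rewrite !linearZ /= [RHS]mulrC.
Qed.

End DualBasis.

(** * Pairings separate tensors; tensors as maps from the dual *)

Section TensorPairing.

Variable K : fieldType.
Implicit Types U V : vectType K.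

(** With basis vectors as left factors, pairing with [coord_form i] isolates row [i]; this is what
    makes pairings separate tensors. *)
Lemma tensor_rows U V (t : tensor U V) :
  t = \sum_i r2v 'e_i \ox r2v (row i t).
Proof.
rewrite {1}[t]tensor_sum; apply: eq_bigr => i _.
rewrite [row i t]row_sum_delta (linear_sum r2v) linear_sumr.
refine (eq_bigr _ _) => j _.
by rewrite (linearZ_LR r2v) linearZr mxE.
Qed.

Lemma tensor_decomp U V (t : tensor U V) :
  exists n (a : 'I_n -> U) (b : 'I_n -> V), t = \sum_i a i \ox b i.
Proof. by do 3!eexists; exact: tensor_rows. Qed.

Lemma tpair_coord U V (t : tensor U V) i (eta : dual V) :
  tpair (coord_form i) eta t = eta (r2v (row i t)).
Proof.
rewrite [in LHS](tensor_rows t) (linear_sum (tpair _ eta)) (bigD1 i) //=.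
rewrite tpair_pure coord_form_basis eqxx mul1r big1 ?addr0 // => j ji.
by rewrite tpair_pure coord_form_basis (negbTE ji) mul0r.
Qed.

Lemma tpair_inj U V (s t : tensor U V) :
  (forall xi eta, tpair xi eta s = tpair xi eta t) -> s = t.
Proof.
move=> st; apply/row_matrixP => i; apply: (can_inj r2vK).
by apply: dual_separates => eta; rewrite -!tpair_coord.
Qed.

Lemma tpair_map U V U' V' (f : 'Hom(U, U')) (g : 'Hom(V, V')) xi eta t :
  tpair xi eta (tmap f g t) = tpair (xi \o f) (eta \o g) t.
Proof.
have [n [a [b ->]]] := tensor_decomp t.
rewrite (linear_sum (tmap f g)) !(linear_sum (tpair _ _)).
by apply: eq_bigr => i _ /=; rewrite tmap_pure !tpair_pure !comp_lfunE.
Qed.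

Lemma tpair_swap U V (t : tensor U V) xi eta :
  tpair eta xi (tswap t) = tpair xi eta t.
Proof.
have [n [a [b ->]]] := tensor_decomp t.
rewrite (linear_sum (@tswap _ _ _)) !(linear_sum (tpair _ _)).
by apply: eq_bigr => i _ /=; rewrite tswap_pure !tpair_pure [LHS]mulrC.
Qed.

Lemma tpairVE U V (t : tensor (dual U) (dual V)) x y :
  tpairV t x y = tpair (evalf x) (evalf y) t.
Proof. by apply: eq_tlift => xi eta; rewrite !evalfE. Qed.

Lemma tpairV_inj U V (s t : tensor (dual U) (dual V)) :
  (forall x y, tpairV s x y = tpairV t x y) -> s = t.
Proof.
move=> st; apply: tpair_inj => phi psi.
have [[x ->] [y ->]] := (evalf_surj phi, evalf_surj psi).
by rewrite -!tpairVE.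
Qed.

(** Only the effect of [F] and [G] at the points [x] and [y] is needed, so multiplications of the
    dual algebra can be moved onto vectors. *)
Lemma tpairV_map U V (F : 'End(dual U)) (G : 'End(dual V))
    (t : tensor (dual U) (dual V)) x y x' y' :
  (forall f, F f x = f x') -> (forall g, G g y = g y') ->
  tpairV (tmap F G t) x y = tpairV t x' y'.
Proof.
move=> Fx Gy; rewrite !tpairVE tpair_map; congr (tpair _ _ t).
  by apply/lfunP => f; rewrite comp_lfunE !evalfE.
by apply/lfunP => g; rewrite comp_lfunE !evalfE.
Qed.

(** Each row of [t] encodes a tensor in the last two factors, to which [tpair_inj] applies. *)
Lemma tpair3_eq0 U V (W : vectType K) (t : tensor U (tensor V W)) :
  (forall (xi : dual U) (eta : dual V) (zeta : dual W),
     tpair xi (linfun (tpair eta zeta)) t = 0) -> t = 0.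
Proof.
move=> t0; apply/row_matrixP => i; apply: (can_inj r2vK).
apply: tpair_inj => eta zeta.
have := t0 (coord_form i) eta zeta.
by rewrite tpair_coord lfunE /= => ->; rewrite row0 !linear0.
Qed.

Lemma rplus_inj (A : vectType K) : injective (@rplus K A).
Proof. by move=> r s rs; apply: tpair_inj => xi eta; rewrite -!rplusP rs. Qed.

Lemma rplus_sum (A : vectType K) n (a b : 'I_n -> A) xi :
  rplus (\sum_i a i \ox b i) xi = \sum_i xi (a i) *: b i.
Proof.
apply: dual_separates => eta.
rewrite rplusP (linear_sum (tpair _ _)) (linear_sum eta).
by apply: eq_bigr => i _ /=; rewrite (linearZ_LR eta) tpair_pure.
Qed.

Lemma rminus_sum (A : vectType K) n (a b : 'I_n -> A) eta :
  rminus (\sum_i a i \ox b i) eta = \sum_i eta (b i) *: a i.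
Proof.
apply: dual_separates => xi.
rewrite rminusP (linear_sum (tpair _ _)) (linear_sum xi).
by apply: eq_bigr => i _ /=; rewrite (linearZ_LR xi) tpair_pure [LHS]mulrC.
Qed.

(** The witness is the canonical tensor of [h], built from dual bases. *)
Lemma rplus_surj (A : vectType K) (h : 'Hom(dual A, A)) :
  exists r, rplus r = h.
Proof.
exists (\sum_i r2v 'e_i \ox h (coord_form i)); apply/lfunP => xi.
rewrite rplus_sum [in RHS](dual_decomp xi) (linear_sum h).
by apply: eq_bigr => i _; rewrite (linearZ_LR h).
Qed.

End TensorPairing.

(** * The symmetrized product and the coboundary cocycle *)

Section ZinbielTheory.

Variables (K : fieldType) (A : vectType K) (mul : {bilinear A -> A -> A}).

Lemma starC x y : star mul x y = star mul y x.
Proof. exact: addrC. Qed.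

(** The Zinbiel identity expands both sides into the sum of all six left-bracketed products of [x],
    [y], [z]. *)
Lemma starA : zinbiel mul ->
  forall x y z, star mul x (star mul y z) = star mul (star mul x y) z.
Proof.
move=> zA x y z; apply: dual_separates => xi.
rewrite /star !linearDr !linearDl !zA /star !linearDl !(linearD xi) /=.
ring.
Qed.

Lemma lrmulE x y : (lmul mul x + rmul mul x) y = star mul x y.
Proof. by rewrite add_lfunE lmulE rmulE. Qed.

Lemma tpair_coboundary (r : tensor A A) xi eta x :
  tpair xi eta (coboundary mul r x) = dual_mul mul r xi eta x.
Proof.
rewrite dual_mulE (linearB (tpair _ _)) /= !tpair_map !comp_lfun1r.
by rewrite -rplusP -rminusP !comp_lfunE lrmulE lmulE starC.
Qed.

Lemma coboundary_cocycle (r : tensor A A) :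
  zinbiel mul -> zinbiel_cocycle mul (coboundary mul r).
Proof.
move=> zA x y; apply: tpair_inj => xi eta.
rewrite tpair_coboundary [RHS](linearD (tpair _ _)) /=.
rewrite !tpair_map !tpair_coboundary !dual_mulE.
rewrite !comp_lfun1r !comp_lfunE !lrmulE lmulE.
(* Both values are [r] paired with the transposes of [lmul x] and of [lmul y + rmul y], so the mixed
   terms cancel. *)
have -> : eta (star mul (rplus r (xi \o lmul mul x)) y)
    = xi (mul x (rminus r (eta \o (lmul mul y + rmul mul y)))).
  rewrite starC -lrmulE -lmulE -(comp_lfunE eta) -(comp_lfunE xi).
  by rewrite rplusP rminusP.
rewrite -zA starA // [star mul y _]starC.
ring.
Qed.

End ZinbielTheory.

(** * The Rota-Baxter product and rescaling of the weight *)

Section RotaBaxter.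

Variables (K : fieldType) (A : vectType K) (mul : {bilinear A -> A -> A}).
Variables (P : 'End(A)) (lambda : K).

Definition rb_mul x y := mul (P x) y + mul x (P y) + lambda *: mul x y.

Lemma rb_mul_zinbiel x y z : zinbiel mul -> rota_baxter mul lambda P ->
  rb_mul x (rb_mul y z) = rb_mul (rb_mul x y + rb_mul y x) z.
Proof.
move=> zA rb; apply: dual_separates => xi.
(* [P] is a morphism from [rb_mul] to [mul]; once it is used, [P] acts on no product and the Zinbiel
   identity for [mul] suffices. *)
have PM u v : P (rb_mul u v) = mul (P u) (P v) by rewrite rb.
have E u v : rb_mul u v = mul (P u) v + mul u (P v) + lambda *: mul u v by [].
rewrite [rb_mul x _]E [rb_mul (rb_mul x y + _) z]E.
have -> : P (rb_mul x y + rb_mul y x) = P (rb_mul x y) + P (rb_mul y x).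
  exact: linearD.
rewrite !PM /rb_mul.
rewrite !(linearDl, linearDr, linearZl_LR, linearZr_LR, zA, linearDl).
rewrite /star !(linearDl, scalerDr, linearZl_LR).
rewrite !(linearD xi, linearZ_LR xi) /=.
ring.
Qed.

Section Quadratic.

Variable omega : {skew_symmetric A}.

Hypothesis H : quadratic_rota_baxter_zinbiel mul P omega lambda.

Lemma skewC x y : omega x y = - omega y x.
Proof. by rewrite hermC expr1 mulN1r. Qed.

Lemma omega_adjoint x y : omega (P x) y = - omega x (P y) - lambda * omega x y.
Proof.
apply/eqP; rewrite -opprD -addr_eq0 addrA; apply/eqP.
by have [] := H.
Qed.

(** The Rota-Baxter equation and the compatibility with [omega] are homogeneous in the pair of [P]
    and [lambda]. *)
Lemma quadratic_scale : lambda != 0 ->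
  quadratic_rota_baxter_zinbiel mul (lambda^-1 *: P) omega 1.
Proof.
move=> l0; have [zA rb nd inv comp] := H; split => //.
  move=> x y; rewrite !scale_lfunE.
  rewrite !linearZl_LR !linearZr_LR /= rb scale1r; congr (_ *: _).
  by rewrite -(linearZ_LR P) !scalerDr scalerK.
move=> x y; rewrite !scale_lfunE linearZl_LR linearZr_LR /=.
rewrite omega_adjoint.
by field.
Qed.

End Quadratic.
End RotaBaxter.

(** * Pairing with [[r, r]], and the coproduct dual to the product *)

Section Coproducts.

Variables (K : fieldType) (A : vectType K) (mul : {bilinear A -> A -> A}).

Lemma star_bilinear : bilinear_for *:%R *:%R (star mul).
Proof. by split=> w c x y; rewrite ?starPl ?starPr. Qed.

HB.instance Definition _ :=
  bilinear_isBilinear.Build K A A A *:%R *:%R (star mul) star_bilinear.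

Lemma starDl x y z : star mul (x + y) z = star mul x z + star mul y z.
Proof. exact: linearDl. Qed.

Lemma starDr x y z : star mul x (y + z) = star mul x y + star mul x z.
Proof. exact: linearDr. Qed.

Lemma starBr x y z : star mul x (y - z) = star mul x y - star mul x z.
Proof. exact: linearBr. Qed.

Lemma bilinear_sum_sum (f : {bilinear A -> A -> A}) (xi : dual A) n
    (c d : 'I_n -> K) (u v : 'I_n -> A) :
  xi (f (\sum_i c i *: u i) (\sum_j d j *: v j)) =
  \sum_i \sum_j c i * d j * xi (f (u i) (v j)).
Proof.
rewrite linear_sumlz (linear_sum xi); apply: eq_bigr => i _.
rewrite linear_sumr (linear_sum xi); apply: eq_bigr => j _.
rewrite linearZl_LR linearZr_LR !(linearZ_LR xi) /=; exact: mulrA.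
Qed.

(** In each term two factors are bare legs of [r]; contracting a left leg gives [rplus r], a right
    leg [rminus r]. *)
Lemma tpair_zybe (r : tensor A A) (xi eta zeta : dual A) :
  tpair xi (linfun (tpair eta zeta)) (zybe mul r) =
  - xi (mul (rminus r zeta) (rminus r eta))
  - eta (mul (rminus r zeta) (rminus r xi))
  + xi (star mul (rminus r zeta) (rplus r eta))
  + eta (star mul (rplus r xi) (rminus r zeta))
  - zeta (star mul (rplus r xi) (rplus r eta)).
Proof.
have [n [a [b ->]]] := tensor_decomp r.
rewrite zybe_sum !rplus_sum !rminus_sum !bilinear_sum_sum.
rewrite -!sumrN -!big_split (linear_sum (tpair _ _)); apply: eq_bigr => i _.
rewrite -!sumrN -!big_split (linear_sum (tpair _ _)); apply: eq_bigr => j _.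
rewrite !(linearD (tpair _ _), linearN (tpair _ _)) /= !tpair_pure !lfunE /=.
rewrite !tpair_pure.
ring.
Qed.

(** The coefficients of [beta] are the structure constants of [mul]. *)
Lemma codual_exists : exists beta : {linear dual A -> tensor (dual A) (dual A)},
  forall xi x y, tpairV (beta xi) x y = xi (mul x y).
Proof.
pose b (xi : dual A) : tensor (dual A) (dual A) :=
  \sum_i \sum_j xi (mul (r2v 'e_i) (r2v 'e_j)) *: (coord_form i \ox coord_form j).
have bl : linear b.
  move=> c xi eta; rewrite /b scaler_sumr -big_split; apply: eq_bigr => i _ /=.
  rewrite scaler_sumr -big_split; apply: eq_bigr => j _ /=.
  by rewrite add_lfunE scale_lfunE scalerDl scalerA.
pose B : {linear dual A -> tensor (dual A) (dual A)} := HB.pack b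
  (GRing.isLinear.Build K (dual A) (tensor (dual A) (dual A)) *:%R b bl).
exists B => xi x y /=.
rewrite tpairVE (linear_sum (tpair _ _)).
rewrite [in RHS](coord_form_decomp x) [in RHS](coord_form_decomp y).
rewrite bilinear_sum_sum; apply: eq_bigr => i _.
rewrite (linear_sum (tpair _ _)); apply: eq_bigr => j _.
by rewrite (linearZ_LR (tpair _ _)) /= tpair_pure !evalfE [LHS]mulrC.
Qed.

End Coproducts.

(** * Weight 1: transport along [J] *)

Section QuadraticWeightOne.

Variables (K : fieldType) (A : vectType K) (mul : {bilinear A -> A -> A}).
Variables (P : 'End(A)) (omega : {skew_symmetric A}) (r : tensor A A).
Hypothesis quad : quadratic_rota_baxter_zinbiel mul P omega 1.
Hypothesis rplusE : rplus r = (P + \1) \o form_iso omega.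
Local Notation J := (form_flat omega).

Let zA : zinbiel mul := qrb_zinbiel quad.
Let nd : nondegenerate omega := qrb_nondegenerate quad.

Lemma omega_mull x y z : omega (mul x y) z = omega y (star mul x z).
Proof. exact: (qrb_invariant quad). Qed.

Lemma omegaDl x y z : omega (x + y) z = omega x z + omega y z.
Proof. exact: linearDl. Qed.

Lemma omega_mulr x y z : omega x (mul y z) = omega (star mul x y) z.
Proof. by rewrite skewC omega_mull -skewC starC. Qed.

Lemma omega_P x y : omega x (P y) = - omega (P x + x) y.
Proof. by rewrite linearDl /= (omega_adjoint quad); ring. Qed.

Lemma form_flat_surj xi : exists x, xi = J x.
Proof. by exists (form_iso omega xi); rewrite form_isoVK. Qed.

Lemma rplusJ x : rplus r (J x) = P x + x.
Proof. by rewrite rplusE comp_lfunE form_isoK // add_lfunE id_lfunE. Qed.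

(** [rminus r] is the transpose of [rplus r], and the [omega]-adjoint of [P + \1] is [- P];
    skew-symmetry absorbs the sign. *)
Lemma rminusJ x : rminus r (J x) = P x.
Proof.
apply: dual_separates => xi; have [y ->] := form_flat_surj xi.
by rewrite rminusP -rplusP rplusJ !form_flatE omega_P -skewC.
Qed.

Lemma rplusBrminusJ x : (rplus r - rminus r) (J x) = x.
Proof. by rewrite add_lfunE opp_lfunE rplusJ rminusJ addrAC subrr add0r. Qed.

Lemma rplusBrminus_bij : bijective (rplus r - rminus r).
Proof.
exists J => [xi|]; last exact: rplusBrminusJ.
by have [x ->] := form_flat_surj xi; rewrite rplusBrminusJ.
Qed.

(** Thus [J] is an algebra isomorphism from the Rota-Baxter product onto the product of A_r^*. *)
Lemma dual_mulJ x y : dual_mul mul r (J x) (J y) = J (rb_mul mul P 1 x y).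
Proof.
apply/lfunP => z; rewrite dual_mulE rplusJ rminusJ !form_flatE /rb_mul.
have -> : omega x (mul z (P y)) = - omega (mul x (P y)) z.
  by rewrite omega_mulr omega_mull -skewC.
rewrite -[omega y _]omega_mull scale1r !linearDl /=.
ring.
Qed.

Lemma dual_mul_zinbiel : zinbiel (dual_mul mul r).
Proof.
move=> xi eta zeta.
have [[x ->] [y ->]] := (form_flat_surj xi, form_flat_surj eta).
have [z ->] := form_flat_surj zeta.
rewrite /star /= !dual_mulJ -(linearD J) /= !dual_mulJ.
by rewrite (rb_mul_zinbiel _ _ _ zA (qrb_rota_baxter quad)).
Qed.

(* The transposes of left and symmetrized multiplication of A_r^* are operators *)
(* on A, so both sides of the dual cocycle identity become values of omega.     *)
Lemma lmul_dual w x f : lmul (dual_mul mul r) (J w) f x =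
  f (star mul (P w + w) x - (P (star mul w x) + star mul w x)).
Proof.
have [v ->] := form_flat_surj f.
rewrite lmulE /= dual_mulJ !form_flatE /rb_mul scale1r.
rewrite !linearDl /= !omega_mull (omega_adjoint quad).
rewrite linearBr !linearDr /=.
ring.
Qed.

Lemma lrmul_dual u y f :
  (lmul (dual_mul mul r) (J u) + rmul (dual_mul mul r) (J u)) f y =
  f (mul (P u) y - P (mul u y)).
Proof.
have [v ->] := form_flat_surj f.
rewrite add_lfunE lmulE rmulE /= !dual_mulJ add_lfunE !form_flatE /rb_mul.
rewrite linearBr /= omega_P !omega_mulr !scale1r !linearDl /=.
rewrite [mul u (_ + _)]linearDr linearDl /=.
ring.
Qed.

Lemma dual_mul_cocycle (beta : {linear dual A -> tensor (dual A) (dual A)}) :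
  (forall xi x y, tpairV (beta xi) x y = xi (mul x y)) ->
  zinbiel_cocycle (dual_mul mul r) beta.
Proof.
move=> betaE xi eta; apply: tpairV_inj => x y.
have [[w ->] [u ->]] := (form_flat_surj xi, form_flat_surj eta).
rewrite betaE [RHS]tpairVE (linearD (tpair _ _)) /= -!tpairVE.
have idE (z : A) (g : dual A) : (\1 : 'End(dual A)) g z = g z.
  by rewrite id_lfunE.
rewrite (tpairV_map _ (lmul_dual w x) (idE y)).
rewrite (tpairV_map _ (idE x) (lrmul_dual u y)) !betaE.
rewrite {1}/star /= !dual_mulJ -(linearD J) /= !form_flatE.
have rb_star : rb_mul mul P 1 w u + rb_mul mul P 1 u w =
    star mul (P w) u + star mul w (P u) + star mul w u.
  apply: dual_separates => chi; rewrite /rb_mul /star !scale1r.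
  by rewrite !(linearD chi) /=; ring.
(* This is the cocycle identity with everything moved to the left of [omega _ y]. The two terms with
   [P (star mul w x)] cancel, and the rest match by associativity and commutativity of [star]. *)
have key : star mul (star mul (P w) u + star mul w (P u) + star mul w u) x =
    star mul u (star mul (P w + w) x - (P (star mul w x) + star mul w x))
    + (star mul (star mul w x) (P u)
       + star mul (P (star mul w x) + star mul w x) u).
  rewrite starBr [star mul (P (star mul w x) + _) u]starC.
  rewrite [RHS]addrCA subrK [RHS]addrC.
  rewrite (starDl _ (_ + _) (star mul w u)) (starDl _ (star mul (P w) u)).
  rewrite (starDl _ (P w) w x) (starDr _ u) [LHS]addrAC; congr (_ + _ + _).
  - by rewrite starA // (starC _ u).
  - by rewrite starA // (starC _ u).
  - by rewrite [RHS]starC starA // (starC _ w).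
have -> : mul x (mul (P u) y - P (mul u y)) =
    mul x (mul (P u) y) - mul x (P (mul u y)) by rewrite linearBr.
rewrite rb_star [omega w _]linearBr /= [omega w (mul x (P _))]omega_mulr omega_P.
by rewrite opprK !omega_mulr key !omegaDl.
Qed.

(** Up to the factor 1/2 the skew part is [rplus r - rminus r], the inverse of [J], so its
    invariance is that of [omega] read through [J]. *)
Lemma rplusBrminus_invariant : L_LR_invariant mul (skew_part r).
Proof.
move=> x; apply/eqP; rewrite subr_eq0; apply/eqP; apply: tpair_inj => xi eta.
rewrite !tpair_map !comp_lfun1r /skew_part.
have skewE f g : tpair f g (r - tswap r) = g ((rplus r - rminus r) f).
  rewrite (linearB (tpair f g)) /= tpair_swap add_lfunE opp_lfunE (linearB g).
  by rewrite -(rplusP r f g) -(rminusP r g f).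
rewrite !(linearZ_LR (tpair _ _)) /= !skewE; congr (_ *: _).
have [y ->] := form_flat_surj xi.
have -> : J y \o lmul mul x = J (star mul y x).
  by apply/lfunP => z; rewrite comp_lfunE lmulE !form_flatE omega_mulr.
by rewrite !rplusBrminusJ comp_lfunE lrmulE starC.
Qed.

Lemma zybe_eq0 : zybe mul r = 0.
Proof.
apply: tpair3_eq0 => xi eta zeta; rewrite tpair_zybe.
have [[x ->] [y ->]] := (form_flat_surj xi, form_flat_surj eta).
have [z ->] := form_flat_surj zeta.
rewrite !rplusJ !rminusJ !form_flatE.
have mulC u v s : omega s (mul u v) = - omega (mul s v) u.
  by rewrite omega_mulr omega_mull -skewC.
rewrite !mulC (skewC _ z) (starC _ (P z)) -!omega_mull !opprK -!omegaDl.
(* The first four terms of the pairing add up to [omega X (P z)]; the last one is the value of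
   [omega] at the [star] product and [z]. *)
pose X := rb_mul mul P 1 x y + rb_mul mul P 1 y x.
have -> : mul x (P y) + mul y (P x) + mul (P y + y) x + mul (P x + x) y = X.
  apply: dual_separates => chi; rewrite /X /rb_mul !scale1r !linearDl.
  by rewrite !(linearD chi) /=; ring.
(* In weight 1, [P + \1] is also a morphism from [rb_mul] to [mul]; this is its symmetrized form. *)
suff -> : star mul (P x + x) (P y + y) = P X + X by rewrite omega_P addNr.
have PM u v : P (rb_mul mul P 1 u v) = mul (P u) (P v).
  by rewrite (qrb_rota_baxter quad).
rewrite /X (linearD P) /= !PM.
apply: dual_separates => chi; rewrite /rb_mul /star !scale1r !linearDl.
rewrite !linearDr !(linearD chi) /=.
ring.
Qed.

Lemma weight_one_factorizable : factorizable_zinbiel_bialgebra mul r.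
Proof.
split; last exact: rplusBrminus_bij.
split; [exact: zybe_eq0 | exact: rplusBrminus_invariant |].
have [beta betaE] := codual_exists mul; exists beta; split=> //.
- exact: dual_mul_zinbiel.
- by move=> x xi eta; rewrite tpair_coboundary.
- exact: coboundary_cocycle.
- exact: dual_mul_cocycle.
Qed.

End QuadraticWeightOne.

Theorem theorem5p11 (K : fieldType) (A : vectType K)
    (mul : {bilinear A -> A -> A}) (P : 'End(A)) (omega : {skew_symmetric A})
    (lambda : K) :
  2%N \notin [pchar K] ->
  quadratic_rota_baxter_zinbiel mul P omega lambda ->
  lambda != 0 ->
  (exists! r : tensor A A,
     rplus r = lambda^-1 *: ((P + lambda *: \1) \o form_iso omega)) /\
  (forall r : tensor A A,
     rplus r = lambda^-1 *: ((P + lambda *: \1) \o form_iso omega) ->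
     zybe mul r = 0 /\ factorizable_zinbiel_bialgebra mul r).
Proof.
move=> _ quad l0; split.
  have [r rE] := rplus_surj (lambda^-1 *: ((P + lambda *: \1) \o form_iso omega)).
  by exists r; split=> // s sE; apply: rplus_inj; rewrite rE sE.
move=> r rE.
(* Dividing by [lambda] gives the weight 1 form of [rplus r] for the operator [lambda^-1 *: P]. *)
have {}rE : rplus r = (lambda^-1 *: P + \1) \o form_iso omega.
  rewrite rE; apply/lfunP => xi.
  rewrite scale_lfunE !comp_lfunE !add_lfunE !scale_lfunE !id_lfunE.
  by rewrite scalerDr scalerA mulVf // scale1r.
have fact := weight_one_factorizable (quadratic_scale quad l0) rE.
by split=> //; have [[]] := fact.
Qed.
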